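(* For every $X\in\{0,1\}^\infty$, the following are equivalent: (1) there exists a computable learning function that uniformly weakly detects that $X$ is patterned; (2) there exists a polynomial-time computable learning function that uniformly weakly detects that $X$ is patterned.
   Context: A learning function is a function $l:\{0,1\}^*\to\{\mathrm{yes},\mathrm{no}\}$. For $Y\in\{0,1\}^\infty$ and $m\in\mathbb N$, $Y\upharpoonright m$ denotes the length-$m$ prefix of $Y$. $\lambda$ denotes the uniform (Lebesgue) probability measure on $\{0,1\}^\infty$, i.e. $\lambda(\{Y: w\sqsubseteq Y\})=2^{-|w|}$. A learning function $l$ uniformly weakly detects that $X$ is patterned iff (i) $l(X\upharpoonright m)=\mathrm{yes}$ for infinitely many $m\in\mathbb N$, and (ii) for all $n\in\mathbb N$, $\lambda(\{Y\in\{0,1\}^\infty : \#\{m\in\mathbb N: l(Y\upharpoonright m)=\mathrm{yes}\}\ge n\})\le 2^{-n}$. A learning function is polynomial-time computable if some Turing machine computes $l(w)$ in time polynomial in $|w|$. *)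

(* Defs.v *)
From mathcomp Require Import all_boot all_order all_algebra.
Set Implicit Arguments. Unset Strict Implicit. Unset Printing Implicit Defensive.
Import Order.TTheory GRing.Theory Num.Theory.

(* A learning function is l : seq bool -> bool (true = yes, false = no) *)

Definition prefix (Y : nat -> bool) (m : nat) : seq bool := mkseq Y m.

Definition in_cyl (w : seq bool) (Y : nat -> bool) : Prop :=
  prefix Y (size w) = w.

(* Lebesgue (uniform) outer measure bound:  lambda*(A) <= b,
   i.e. for every eps > 0 there is a countable cover of A by cylinders
   [c 0], [c 1], ... with  sum_i 2^{-|c i|} <= b + eps.
   (lambda*(A) = inf over cylinder covers of sum_i 2^{-|c i|};
    it coincides with lambda on measurable, in particular open, sets.) *)
Definition lambda_le (A : (nat -> bool) -> Prop) (b : rat) : Prop :=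
  forall eps : rat, (0 < eps)%R ->
    exists c : nat -> seq bool,
      (forall Y, A Y -> exists i, in_cyl (c i) Y) /\
      (forall N : nat, \sum_(i < N) ((2%:R : rat) ^- size (c i)) <= b + eps)%R.

Definition at_least_n_yes (l : seq bool -> bool) (n : nat) (Y : nat -> bool) : Prop :=
  exists s : seq nat, uniq s /\ n <= size s /\ all (fun m => l (prefix Y m)) s.

Definition uniformly_weakly_detects (l : seq bool -> bool) (X : nat -> bool) : Prop :=
  (forall N, exists m, N <= m /\ l (prefix X m)) /\
  (forall n : nat, lambda_le (at_least_n_yes l n) ((2%:R : rat) ^- n)%R).

(* Deterministic single-tape Turing machines (two-way infinite tape).  *)
(* Alphabet: option bool (None = blank).  Finitely many states 'I_n.+1,*)
(* start state ord0.  delta q a = None means: halt.                    *)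

Inductive move := MLeft | MRight | MStay.

Record TM := {
  tm_n : nat;
  tm_delta : 'I_tm_n.+1 -> option bool -> option ('I_tm_n.+1 * option bool * move)
}.

Record config (M : TM) := Config {
  c_state : 'I_(tm_n M).+1;
  c_left  : seq (option bool);   (* cells left of head, nearest first *)
  c_cur   : option bool;
  c_right : seq (option bool)    (* cells right of head, nearest first *)
}.

Definition step (M : TM) (c : config M) : option (config M) :=
  match tm_delta (c_state c) (c_cur c) with
  | None => None
  | Some (q', s, mv) =>
    Some match mv with
    | MStay => Config q' (c_left c) s (c_right c)
    | MLeft => match c_left c with
               | [::] => Config q' [::] None (s :: c_right c)
               | x :: l' => Config q' l' x (s :: c_right c)
               end
    | MRight => match c_right c with
               | [::] => Config q' (s :: c_left c) None [::]
               | x :: r' => Config q' (s :: c_left c) x r'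
               end
    end
  end.

Fixpoint exec (M : TM) (k : nat) (c : config M) : option (config M) :=
  match step c with
  | None => Some c
  | Some c' => match k with 0 => None | k'.+1 => exec k' c' end
  end.

Definition init (M : TM) (w : seq bool) : config M :=
  match w with
  | [::] => Config ord0 [::] None [::]
  | b :: w' => Config ord0 [::] (Some b) (map Some w')
  end.

Definition output (M : TM) (c : config M) : bool := c_cur c == Some true.

Definition computable_lf (l : seq bool -> bool) : Prop :=
  exists M : TM, forall w : seq bool,
    exists k (c : config M), exec k (init M w) = Some c /\ output c = l w.

(* halts within a * (|w|+1)^d steps; such bounds dominate every polynomial *)
Definition ptime_lf (l : seq bool -> bool) : Prop :=
  exists (M : TM) (a d : nat), forall w : seq bool,
    exists c : config M, exec (a * (size w).+1 ^ d) (init M w) = Some c /\ output c = l w.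

(* Main.v *)
From HB Require Import structures.
Require Import Defs.
From mathcomp Require Import all_boot all_order all_algebra zify.
From Stdlib Require Import BinInt.
Set Implicit Arguments. Unset Strict Implicit. Unset Printing Implicit Defensive.
#[local] Arguments Z.mul : simpl never.
#[local] Arguments Z.add : simpl never.

(* Let [M] compute [l]. The delayed function answers yes on [w] iff, for some
   [j < |w|], [M] accepts the prefix of [w] of length [j] in exactly
   [|w| - j - 1] steps. Each yes of [l] at length [j] along a sequence is thus
   announced once, at the later length determined by [j] and the running time of
   [M]: infinitely many yeses stay infinitely many, and their number never grows,
   so the measure bounds are inherited. The delayed function runs in polynomial
   time, since each [j] requires fewer than [|w|] steps of [M].

   The polynomial-time machine works on a four-track tape, the clock of the
   simulation being a mark that moves along the input. The tracks are then packed
   into the three-symbol alphabet by replacing twice an alphabet of pairs by its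
   components on adjacent cells. *)

(** * Machines on tapes indexed by the integers *)

Definition upd A (T : Z -> A) (p : Z) (a : A) : Z -> A :=
  fun z => if Z.eqb z p then a else T z.

Lemma upd_eq A (T : Z -> A) p a : upd T p a p = a.
Proof. by rewrite /upd Z.eqb_refl. Qed.

Lemma upd_neq A (T : Z -> A) p a z : z <> p -> upd T p a z = T z.
Proof. by rewrite /upd; case: Z.eqb_spec. Qed.

Lemma eq_upd A (T T' : Z -> A) p a : T =1 T' -> upd T p a =1 upd T' p a.
Proof. by move=> eT z; rewrite /upd eT. Qed.

Definition disp (m : option bool) : Z :=
  match m with None => 0 | Some true => 1 | Some false => -1 end%Z.

(* A machine with states [S] and alphabet [A] is a transition function
   [S -> A -> bool + S * A * option bool]: either halt with a verdict, or go to
   a state, write a symbol and move ([None]: stay, [Some true]: right). *)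
Section Machines.
Variables (S A : Type) (delta : S -> A -> bool + S * A * option bool).

(** The number only bounds the running time, so budgets may be rounded up; [verdict_at] demands the
    exact count, on which the delay rests. *)
Inductive halts : nat -> S -> Z -> (Z -> A) -> bool -> Prop :=
| halts_now B q p T b : delta q (T p) = inl b -> halts B q p T b
| halts_step B q p T b q' a m : delta q (T p) = inr (q', a, m) ->
    halts B q' (p + disp m)%Z (upd T p a) b -> halts B.+1 q p T b.

Lemma halts_mono B B' q p T b : B <= B' -> halts B q p T b -> halts B' q p T b.
Proof.
move=> leB h; elim: h B' leB => {B q p T b} [B q p T b e|B q p T b q' a m e _ IH] B' leB.
  exact: halts_now.
by case: B' leB => // B' leB; apply: (halts_step e); apply: IH.
Qed.

Lemma halts_ext B q p T T' b : T =1 T' -> halts B q p T b -> halts B q p T' b.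
Proof.
move=> eT h; elim: h T' eT => {B q p T b} [B q p T b e|B q p T b q' a m e _ IH] T' eT.
  by apply: halts_now; rewrite -eT.
by apply: (@halts_step _ _ _ _ _ q' a m); [rewrite -eT | apply: IH; apply: eq_upd].
Qed.

Lemma halts_move B q p T b q' m : delta q (T p) = inr (q', T p, m) ->
  halts B q' (p + disp m)%Z T b -> halts B.+1 q p T b.
Proof.
move=> e h; apply: (halts_step e); apply: halts_ext h => z.
by rewrite /upd; case: Z.eqb_spec => // ->.
Qed.

Fixpoint verdict_at (k : nat) (q : S) (p : Z) (T : Z -> A) : option bool :=
  match delta q (T p), k with
  | inl b, 0 => Some b
  | inr (q', a, m), k'.+1 => verdict_at k' q' (p + disp m)%Z (upd T p a)
  | _, _ => None
  end.

Lemma verdict_at_inj k k' q p T b b' :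
  verdict_at k q p T = Some b -> verdict_at k' q p T = Some b' -> k = k' /\ b = b'.
Proof.
elim: k k' q p T => [|k IH] [|k'] q p T /=; case: (delta q (T p)) => [c|[[q' a] m]] //.
  by move=> [<-] [<-].
by move=> h h'; case: (IH _ _ _ _ h h') => -> ->.
Qed.

End Machines.

(** * Configurations of Turing machines as integer tapes *)

Definition input (w : seq bool) (z : Z) : option bool :=
  if (0 <=? z)%Z then onth w (Z.to_nat z) else None.

(** Reading the lists with default [None] turns an exhausted list into an endless blank
    half-tape. *)
Definition tape_of M (c : config M) (p : Z) (T : Z -> option bool) : Prop :=
  [/\ T p = c_cur c,
      forall i : nat, T (p - 1 - Z.of_nat i)%Z = nth None (c_left c) i
    & forall i : nat, T (p + 1 + Z.of_nat i)%Z = nth None (c_right c) i].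

Lemma tape_of_init M w : tape_of (init M w) 0 (input w).
Proof.
split=> [|i|i].
- by case: w.
- by rewrite /input; case: Z.leb_spec => [|_]; [lia|case: w => [|? ?]; rewrite nth_nil].
- rewrite /input; case: Z.leb_spec => [_|]; last by lia.
  have -> : Z.to_nat (0 + 1 + Z.of_nat i) = i.+1 by lia.
  by case: w => [|b w] /=; rewrite ?nth_nil ?onthE.
Qed.

Definition move_code (m : move) : option bool :=
  match m with MLeft => Some false | MRight => Some true | MStay => None end.

Definition delta_of (M : TM) q a : bool + 'I_(tm_n M).+1 * option bool * option bool :=
  match tm_delta q a with
  | None => inl (a == Some true)
  | Some (q', s, m) => inr (q', s, move_code m)
  end.

Lemma tape_of_step M (c : config M) p T q' s m :
  tape_of c p T -> tm_delta (c_state c) (c_cur c) = Some (q', s, m) ->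
  exists c', [/\ step c = Some c', c_state c' = q'
    & tape_of c' (p + disp (move_code m))%Z (upd T p s)].
Proof.
case: c => q l x r [/= hx hl hr] e; rewrite /step /= e.
case: m {e} => /=.
- case: l hl => [|y l] hl; eexists; (split; first reflexivity) => //; split => /=.
  + by rewrite upd_neq; [move: (hl 0); rewrite Z.sub_0_r|lia].
  + move=> i; rewrite upd_neq; last by lia.
    by move: (hl i.+1); rewrite !nth_nil => <-; congr T; lia.
  + case=> [|i] /=; first by rewrite (_ : (_ + _)%Z = p) ?upd_eq //; lia.
    by rewrite upd_neq -?hr; [congr T|]; lia.
  + by rewrite upd_neq; [move: (hl 0); rewrite Z.sub_0_r|lia].
  + move=> i; rewrite upd_neq; last by lia.
    by move: (hl i.+1) => /= <-; congr T; lia.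
  + case=> [|i] /=; first by rewrite (_ : (_ + _)%Z = p) ?upd_eq //; lia.
    by rewrite upd_neq -?hr; [congr T|]; lia.
- case: r hr => [|y r] hr; eexists; (split; first reflexivity) => //; split => /=.
  + by rewrite upd_neq; [move: (hr 0); rewrite Z.add_0_r|lia].
  + case=> [|i] /=; first by rewrite (_ : (_ - _ - _)%Z = p) ?upd_eq //; lia.
    by rewrite upd_neq -?hl; [congr T|]; lia.
  + move=> i; rewrite upd_neq; last by lia.
    by move: (hr i.+1); rewrite !nth_nil => <-; congr T; lia.
  + by rewrite upd_neq; [move: (hr 0); rewrite Z.add_0_r|lia].
  + case=> [|i] /=; first by rewrite (_ : (_ - _ - _)%Z = p) ?upd_eq //; lia.
    by rewrite upd_neq -?hl; [congr T|]; lia.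
  + move=> i; rewrite upd_neq; last by lia.
    by move: (hr i.+1) => /= <-; congr T; lia.
- eexists; (split; first reflexivity) => //; split => /=.
  + by rewrite Z.add_0_r upd_eq.
  + by move=> i; rewrite upd_neq -?hl; [congr T|]; lia.
  + by move=> i; rewrite upd_neq -?hr; [congr T|]; lia.
Qed.

Lemma exec_verdict M k (c c' : config M) p T :
  tape_of c p T -> exec k c = Some c' ->
  exists t, verdict_at (@delta_of M) t (c_state c) p T = Some (output c').
Proof.
elim: k c p T => [|k IH] c p T rc /=.
  have [hx _ _] := rc.
  case e: (tm_delta (c_state c) (c_cur c)) => [[[q' s] m]|].
    by have [c1 [-> _ _]] := tape_of_step rc e.
  rewrite /step e => -[<-]; exists 0 => /=.
  by rewrite /delta_of hx e.
have [hx _ _] := rc.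
case e: (tm_delta (c_state c) (c_cur c)) => [[[q' s] m]|].
  have [c1 [-> hq rc1]] := tape_of_step rc e.
  move=> /(IH _ _ _ rc1) [t ht]; exists t.+1 => /=.
  by rewrite /delta_of hx e -hq.
rewrite /step e => -[<-]; exists 0 => /=.
by rewrite /delta_of hx e.
Qed.

(** The encoding [e] of input symbols is a parameter so that the alphabet can be shrunk in stages,
    down to [e = id]. *)
Definition ptime_on A (e : option bool -> A) (l : seq bool -> bool) : Prop :=
  exists (S : finType) (delta : S -> A -> bool + S * A * option bool) (q0 : S) (a d : nat),
    forall w, halts delta (a * (size w).+1 ^ d) q0 0 (e \o input w) (l w).

(** * From finite-state machines back to Turing machines *)

Section ToTM.
Variables (S : finType) (delta : S -> option bool -> bool + S * option bool * option bool).
Variable q0 : S.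

Definition code_move (m : option bool) : move :=
  match m with Some false => MLeft | Some true => MRight | None => MStay end.

(* Code 0 is the start state, code [k.+1] the [k]-th state of [S], and the last
   code is a halting state entered after the verdict is written on the tape. *)
Definition state_dec (i : 'I_(#|S|.+1).+1) : option S :=
  if nat_of_ord i == 0 then Some q0 else
  if insub (nat_of_ord i).-1 is Some j then Some (enum_val (j : 'I_#|S|)) else None.

Definition state_enc (o : option S) : 'I_(#|S|.+1).+1 :=
  if o is Some q then inord (enum_rank q).+1 else ord_max.

Lemma state_encK : cancel state_enc state_dec.
Proof.
case=> [q|] /=; rewrite /state_dec /=.
  have lt := ltn_ord (enum_rank q).
  rewrite inordK /=; last by rewrite ltnS ltnW.
  by rewrite valK /= enum_rankK.
by rewrite insubF // ltnn.
Qed.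

Definition TM_of : TM := {| tm_n := #|S|.+1; tm_delta := fun i a =>
  if state_dec i is Some q then
    match delta q a with
    | inl b => Some (state_enc None, Some b, MStay)
    | inr (q', s, m) => Some (state_enc (Some q'), s, code_move m)
    end
  else None |}.

(** The step beyond [B] writes the verdict under the head while entering the halting state. *)
Lemma exec_TM_of B q p T b (c : config TM_of) :
  halts delta B q p T b -> state_dec (c_state c) = Some q -> tape_of c p T ->
  exists c', exec B.+1 c = Some c' /\ output c' = b.
Proof.
move=> h; elim: h c => {B q p T b} [B q p T b e|B q p T b q' a m e _ IH] c hq rc;
  have [hx _ _] := rc.
  have hd : tm_delta (c_state c) (c_cur c) = Some (state_enc None, Some b, MStay).
    by rewrite /= hq -hx e.
  have [c1 [hs hq1 [hx1 _ _]]] := tape_of_step rc hd.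
  exists c1.
  have hs1 : step c1 = None by rewrite /step /= hq1 state_encK.
  move: hx1; rewrite /output /= Z.add_0_r upd_eq => <-; rewrite hs.
  by split; [case: B {e} => [|B]; rewrite /= hs1 | case: b {e hd}].
have hd : tm_delta (c_state c) (c_cur c) = Some (state_enc (Some q'), a, code_move m).
  by rewrite /= hq -hx e.
have [c1 [hs hq1 rc1]] := tape_of_step rc hd.
have em : move_code (code_move m) = m by case: (m) => [[]|].
rewrite em in rc1.
have [|c' [hc' ho]] := IH c1 _ rc1; first by rewrite hq1 state_encK.
by exists c'; split => //; move: hc' => /=; rewrite hs.
Qed.

End ToTM.

Lemma ptime_on_id l : ptime_on id l -> ptime_lf l.
Proof.
move=> [S [delta [q0 [a [d h]]]]].
(* The increment of [a] pays for the step that writes the verdict. *)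
exists (TM_of delta q0), a.+1, d => w.
have hs : state_dec q0 (c_state (init (TM_of delta q0) w)) = Some q0 by case: w.
have gt0 : 0 < (size w).+1 ^ d by rewrite expn_gt0.
have le : a * (size w).+1 ^ d <= (a.+1 * (size w).+1 ^ d).-1 by lia.
have [c] := exec_TM_of (halts_mono le (h w)) hs (tape_of_init _ w).
by rewrite prednK ?muln_gt0 //; exists c.
Qed.

(** * Reduction of the alphabet *)

(** The states up to [Enter] spread the input over alternate cells. The others simulate: two cells
    are read and rewritten, and [Align] repeats the move of [Write1] so that the head crosses a
    whole pair. *)
Inductive pair_state (Q A : Type) :=
| ScanRight | Pick | Carry (x : bool) | Gap (o : option bool) | Code (o : option bool)
| GapBack | CodeBack | Enter
| Read1 (q : Q) | Read2 (q : Q) (a : A) | Write1 (q : Q) (a : A) (m : option bool)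
| Align (q : Q) (m : option bool).

Section PairStateFinite.
Variables Q A : finType.

Definition pair_state_code : finType :=
  ('I_5 + (bool + (bool * option bool) + (Q + Q * A + Q * A * option bool + Q * option bool)))%type.

Definition pair_state_enc (s : pair_state Q A) : pair_state_code :=
  match s with
  | ScanRight => inl (inord 0) | Pick => inl (inord 1) | GapBack => inl (inord 2)
  | CodeBack => inl (inord 3) | Enter => inl (inord 4)
  | Carry x => inr (inl (inl x)) | Gap o => inr (inl (inr (true, o)))
  | Code o => inr (inl (inr (false, o)))
  | Read1 q => inr (inr (inl (inl (inl q)))) | Read2 q a => inr (inr (inl (inl (inr (q, a)))))
  | Write1 q a m => inr (inr (inl (inr (q, a, m)))) | Align q m => inr (inr (inr (q, m)))
  end.

Definition pair_state_dec (x : pair_state_code) : pair_state Q A :=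
  match x with
  | inl i => match nat_of_ord i with
             | 0 => ScanRight _ _ | 1 => Pick _ _ | 2 => GapBack _ _
             | 3 => CodeBack _ _ | _ => Enter _ _ end
  | inr (inl (inl x)) => Carry _ _ x
  | inr (inl (inr (true, o))) => Gap _ _ o
  | inr (inl (inr (false, o))) => Code _ _ o
  | inr (inr (inl (inl (inl q)))) => Read1 _ q
  | inr (inr (inl (inl (inr (q, a))))) => Read2 q a
  | inr (inr (inl (inr (q, a, m)))) => Write1 q a m
  | inr (inr (inr (q, m))) => Align _ q m
  end.

Lemma pair_state_encK : cancel pair_state_enc pair_state_dec.
Proof. by case=> //=; rewrite inordK. Qed.

HB.instance Definition _ := Finite.copy (pair_state Q A) (can_type pair_state_encK).

End PairStateFinite.

(** * Simulating a cell of pairs by two adjacent cells *)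

Section Pairs.
Variables (A Q : finType) (e : option bool -> A) (d : A -> option bool).
Hypothesis eK : cancel e d.
Variables (delta : Q -> A * A -> bool + Q * (A * A) * option bool) (q0 : Q).

Notation state := (pair_state Q A).
Notation left := (Some false).
Notation right := (Some true).

(** [Pick] takes the last remaining bit and [Code] deposits it in the first free place. Carrying
    [None] means that the input is exhausted; the free place found then borders the leftmost
    pair. *)
Definition pair_delta (s : state) (a : A) : bool + state * A * option bool :=
  match s with
  | ScanRight => if d a then inr (ScanRight _ _, a, right) else inr (Pick _ _, a, left)
  | Pick => if d a is Some x then inr (Carry _ _ x, e None, left)
            else inr (Gap _ _ None, a, left)
  | Carry x => if d a then inr (Carry _ _ x, a, left) else inr (Gap _ _ (Some x), a, left)
  | Gap o => inr (Code _ _ o, a, left)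
  | Code o => if d a then inr (Gap _ _ o, a, left)
              else if o then inr (GapBack _ _, e o, right)
              else inr (Enter _ _, a, right)
  | GapBack => inr (CodeBack _ _, a, right)
  | CodeBack => if d a then inr (GapBack _ _, a, right) else inr (ScanRight _ _, a, right)
  | Enter => inr (Read1 _ q0, a, right)
  | Read1 q => inr (Read2 q a, a, right)
  | Read2 q a1 => match delta q (a1, a) with
                  | inl b => inl b
                  | inr (q', (a1', a2'), m) => inr (Write1 q' a1' m, a2', left)
                  end
  | Write1 q a1 m => inr (Align _ q m, a1, m)
  | Align q m => inr (Read1 _ q, a, m)
  end.

Notation H := (halts pair_delta).

Definition interleaved (T : Z -> A) (p0 : Z) (U : Z -> A * A) : Prop :=
  forall z, T (p0 + 2 * z)%Z = (U z).1 /\ T (p0 + 2 * z + 1)%Z = (U z).2.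

(** Each simulated step takes four steps; one more is needed since the verdict falls only on the
    second cell of a pair. *)
Lemma halts_interleaved B q p U b T p0 :
  halts delta B q p U b -> interleaved T p0 U ->
  H (4 * B + 1) (Read1 _ q) (p0 + 2 * p)%Z T b.
Proof.
move=> h; elim: h T => {B q p U b} [B q p U b eq|B q p U b q' [a1 a2] m eq _ IH] T rT;
  have [e1 e2] := rT p.
  rewrite addn1; apply: halts_move; first by rewrite /=.
  by apply: halts_now; rewrite /= e1 e2 -surjective_pairing eq.
have -> : 4 * B.+1 + 1 = (4 * B + 1).+4 by lia.
apply: halts_move; first by rewrite /=.
apply: halts_step; first by rewrite /= e1 e2 -surjective_pairing eq.
apply: halts_step; first by [].
apply: halts_move; first by [].
set T' := upd _ _ _.
have rT' : interleaved T' p0 (upd U p (a1, a2)).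
  move=> z; rewrite /T' /upd /=; have [r1 r2] := rT z.
  by split; repeat (case: Z.eqb_spec => ? //=); lia.
move: (IH _ rT'); congr H; case: (m) => [[]|] /=; lia.
Qed.

(* Input bits are moved one at a time from the right end of the input, occupying
   [0, |r|), to the region left of -2, where the bit picked i-th sits at -3-2i. *)
Definition spreading (T : Z -> A) (r u : seq bool) : Prop :=
  [/\ forall i : nat, T (Z.of_nat i) = e (onth r i), T (-1)%Z = e None,
      forall i : nat, T (-2 - 2 * Z.of_nat i)%Z = e None
    & forall i : nat, T (-3 - 2 * Z.of_nat i)%Z = e (onth u i)].

Lemma halts_ScanRight B T r u b k i : spreading T r u -> i + k = size r ->
  H B (Pick _ _) (Z.of_nat (size r) - 1)%Z T b ->
  H (B + k.+1) (ScanRight _ _) (Z.of_nat i) T b.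
Proof.
move=> [hr _ _ _] ik hB; elim: k i ik => [|k IH] i ik; rewrite addnS.
  apply: halts_move; first by rewrite /= hr eK onth_default //; lia.
  by rewrite addn0 (_ : i = size r) //; lia.
apply: halts_move; first by rewrite /= hr eK onthTE (_ : _ < _) //; lia.
have -> : (Z.of_nat i + disp right = Z.of_nat i.+1)%Z by rewrite /=; lia.
by apply: IH; lia.
Qed.

Lemma halts_Carry B T r u b x i : spreading T r u -> i <= size r ->
  H B (Gap _ _ (Some x)) (-2)%Z T b ->
  H (B + i.+1) (Carry _ _ x) (Z.of_nat i - 1)%Z T b.
Proof.
move=> [hr h1 _ _] ir hB; elim: i ir => [|i IH] ir; rewrite addnS.
  by rewrite addn0; apply: halts_move; first by rewrite /= h1 eK.
have -> : (Z.of_nat i.+1 - 1 = Z.of_nat i)%Z by lia.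
apply: halts_move; first by rewrite /= hr eK onthTE ir.
by apply: IH; lia.
Qed.

Lemma halts_Code B T r u b o k i : spreading T r u -> i + k = size u ->
  H B (Code _ _ o) (-3 - 2 * Z.of_nat (size u))%Z T b ->
  H (B + 2 * k) (Code _ _ o) (-3 - 2 * Z.of_nat i)%Z T b.
Proof.
move=> [_ _ _ hu] ik hB; elim: k i ik => [|k IH] i ik.
  by rewrite addn0 (_ : i = size u) //; lia.
have -> : B + 2 * k.+1 = (B + 2 * k).+2 by lia.
apply: halts_move; first by rewrite /= hu eK onthTE (_ : _ < _) //; lia.
apply: halts_move; first by [].
have -> : (-3 - 2 * Z.of_nat i + disp left + disp left = -3 - 2 * Z.of_nat i.+1)%Z.
  by rewrite /=; lia.
by apply: IH; lia.
Qed.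

Lemma halts_CodeBack B T r u b i : spreading T r u -> i <= size u ->
  H B (ScanRight _ _) 0%Z T b ->
  H (B + (2 * i).+1) (CodeBack _ _) (-1 - 2 * Z.of_nat i)%Z T b.
Proof.
move=> [_ h1 _ hu] iu hB; elim: i iu => [|i IH] iu; rewrite addnS.
  by rewrite addn0; apply: halts_move; first by rewrite /= h1 eK.
have -> : (-1 - 2 * Z.of_nat i.+1 = -3 - 2 * Z.of_nat i)%Z by lia.
have -> : B + 2 * i.+1 = (B + (2 * i).+1).+1 by lia.
apply: halts_move; first by rewrite /= hu eK onthTE iu.
apply: halts_move; first by [].
have -> : (-3 - 2 * Z.of_nat i + disp right + disp right = -1 - 2 * Z.of_nat i)%Z.
  by rewrite /=; lia.
by apply: IH; lia.
Qed.

Lemma spreading_step T r x u : spreading T (rcons r x) u ->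
  spreading (upd (upd T (Z.of_nat (size r)) (e None)) (-3 - 2 * Z.of_nat (size u))%Z
                 (e (Some x))) r (rcons u x).
Proof.
move=> [hr h1 h2 hu]; split=> [i||i|i].
- rewrite upd_neq; last by lia.
  rewrite /upd; case: Z.eqb_spec => [ei|ne].
    by rewrite onth_default //; lia.
  rewrite hr -cats1 onth_cat; case: ltnP => // le.
  by rewrite !onth_default //=; lia.
- by rewrite !upd_neq //; lia.
- by rewrite !upd_neq //; lia.
- rewrite /upd; case: Z.eqb_spec => [ei|ne].
    by rewrite -cats1 onth_cat (_ : i = size u) ?ltnn ?subnn //; lia.
  case: Z.eqb_spec => [|_]; first by lia.
  rewrite hu -cats1 onth_cat; case: ltnP => // le.
  by rewrite !onth_default //=; lia.
Qed.

(** Bits leave from the right end, hence the reversal, and each round trip costs at most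
    [4 * n + 8]. The continuation ranges over all tapes because [spreading] fixes a tape only
    pointwise. *)
Lemma halts_spread B b n r u T : spreading T r u -> size r + size u = n ->
  (forall T', spreading T' [::] (u ++ rev r) -> H B (ScanRight _ _) 0%Z T' b) ->
  H (B + size r * (4 * n + 8)) (ScanRight _ _) 0%Z T b.
Proof.
elim/last_ind: r u T => [|r x IH] u T sp en hB.
  by rewrite mul0n addn0; apply: hB; rewrite cats0.
rewrite size_rcons in en *.
have sp' := spreading_step sp.
have {}hB : H (B + size r * (4 * n + 8)) (ScanRight _ _) 0%Z
    (upd (upd T (Z.of_nat (size r)) (e None)) (-3 - 2 * Z.of_nat (size u))%Z (e (Some x))) b.
  apply: (IH (rcons u x)) => //; first by rewrite size_rcons; lia.
  by move=> T'; rewrite cat_rcons -rev_rcons; apply: hB.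
set T1 := upd T (Z.of_nat (size r)) (e None) in sp' hB.
have sp1 : spreading T1 r u.
  have [hr h1 h2 hu] := sp; split=> [i||i|i]; rewrite /T1.
  - rewrite /upd; case: Z.eqb_spec => [ei|ne].
      by rewrite onth_default //; lia.
    rewrite hr -cats1 onth_cat; case: ltnP => // le.
    by rewrite !onth_default //=; lia.
  - by rewrite upd_neq //; lia.
  - by rewrite upd_neq //; lia.
  - by rewrite upd_neq //; lia.
(* From the outside in: [ScanRight], [Pick], [Carry], [Gap], the walk in [Code], its final write,
   [GapBack], [CodeBack]. *)
apply: (@halts_mono _ _ _
  (((((((B + size r * (4 * n + 8)) + (2 * size u).+1).+1).+1 + 2 * size u).+1) + (size r).+1).+1
    + (size r).+2)); first by nia.
apply: (@halts_ScanRight _ T (rcons r x) u b (size r).+1 0) => //; first by rewrite size_rcons.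
have -> : (Z.of_nat (size (rcons r x)) - 1 = Z.of_nat (size r))%Z by rewrite size_rcons; lia.
have [hr _ _ _] := sp.
apply: halts_step; first by rewrite /= hr eK -cats1 onth_cat ltnn subnn /=.
apply: (halts_Carry sp1) => //.
apply: halts_move; first by [].
apply: (@halts_Code _ _ r u _ _ (size u) 0 sp1) => //.
have [_ _ _ hu] := sp1.
apply: halts_step; first by rewrite /= hu eK onth_default.
apply: halts_move; first by [].
have -> : (-3 - 2 * Z.of_nat (size u) + disp right + disp right = -1 - 2 * Z.of_nat (size u))%Z.
  by rewrite /=; lia.
by apply: (halts_CodeBack sp'); rewrite ?size_rcons.
Qed.

Lemma spreading_input w : spreading (e \o input w) w [::].
Proof.
split=> [i||i|i] //=; rewrite /input; case: Z.leb_spec => [h|h]; try lia.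
  by rewrite (_ : Z.to_nat (Z.of_nat i) = i) //; lia.
all: by rewrite ?onth0n.
Qed.

(** With [n] the length of [w], bit [z] is picked in round [n - 1 - z], counted from 0, so it sits
    at [-3 - 2 * (n - 1 - z)], which is [2 * z] beyond the origin [-1 - 2 * n]. *)
Lemma interleaved_spread T w : spreading T [::] (rev w) ->
  interleaved T (-1 - 2 * Z.of_nat (size w))%Z (fun z => (e (input w z), e None)).
Proof.
move=> [hr h1 h2 hu] z; split=> /=; last first.
  case: (Z.leb_spec (Z.of_nat (size w)) z) => h.
    have -> : (-1 - 2 * Z.of_nat (size w) + 2 * z + 1 =
               Z.of_nat (Z.to_nat (2 * z - 2 * Z.of_nat (size w))))%Z by lia.
    by rewrite hr onth0n.
  by rewrite -(h2 (Z.to_nat (Z.of_nat (size w) - z - 1))); congr T; lia.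
case: (Z.leb_spec (Z.of_nat (size w)) z) => h.
  rewrite /input; case: Z.leb_spec => [h0|]; last by lia.
  rewrite onth_default; last by lia.
  case: (Z.eqb_spec z (Z.of_nat (size w))) => [ez|ne].
    by rewrite -h1; congr T; lia.
  have -> : (-1 - 2 * Z.of_nat (size w) + 2 * z =
               Z.of_nat (Z.to_nat (2 * z - 2 * Z.of_nat (size w) - 1)))%Z by lia.
  by rewrite hr onth0n.
have -> : (-1 - 2 * Z.of_nat (size w) + 2 * z =
           -3 - 2 * Z.of_nat (Z.to_nat (Z.of_nat (size w) - z - 1)))%Z by lia.
rewrite hu /input; case: Z.leb_spec => [h0|h0]; last first.
  by rewrite onth_default // size_rev; lia.
rewrite !onthE map_rev nth_rev size_map; last by lia.
by congr (e (nth _ _ _)); lia.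
Qed.

Lemma pair_halts B w b :
  halts delta B q0 0 (fun z => (e (input w z), e None)) b ->
  H (4 * B + 20 * (size w).+1 ^ 2) (ScanRight _ _) 0%Z (e \o input w) b.
Proof.
move=> hB; set n := size w.
apply: (@halts_mono _ _ _ ((4 * B + 1 + 5 + 2 * n) + n * (4 * n + 8))); first by nia.
apply: (halts_spread (spreading_input w)); first by rewrite addn0.
move=> T sp.
have -> : 4 * B + 1 + 5 + 2 * n = ((4 * B + 1).+2 + 2 * n).+3 by lia.
have [hr h1 _ hu] := sp.
apply: halts_move; first by rewrite /= (hr 0) eK.
apply: halts_move; first by rewrite /= h1 eK.
apply: halts_move; first by [].
apply: (@halts_Code _ _ [::] (rev w) _ _ n 0 sp); first by rewrite size_rev.
(* Two cells to the right of the first free place lies the pair of index 0. *)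
apply: halts_move; first by rewrite /= hu eK onth_default.
apply: halts_move; first by [].
move: (halts_interleaved hB (interleaved_spread sp)); congr H.
by rewrite /= size_rev; lia.
Qed.

End Pairs.

(* One level of alphabet reduction: a cell of the pair machine is simulated by
   two adjacent cells. *)
Lemma ptime_on_pair (A : finType) (e : option bool -> A) d l : cancel e d ->
  ptime_on (fun o => (e o, e None)) l -> ptime_on e l.
Proof.
move=> eK [Q [delta [q0 [a [k h]]]]].
exists (pair_state Q A : finType), (pair_delta e d delta q0), (ScanRight _ _), (4 * a + 20), (k + 2) => w.
apply: halts_mono (pair_halts eK (h w)).
have X1 : 0 < (size w).+1 ^ k by rewrite expn_gt0.
have X2 : 0 < (size w).+1 ^ 2 by rewrite expn_gt0.
by rewrite expnD; nia.
Qed.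

(** * The clocked simulation *)

(** [Next] to [Copy] set up a prefix and its clock; [Run] to [Return] make one simulated step and
    one tick; [Clear] and [SeekIndex] wipe the tape for the next prefix. [Seek] carries a simulated
    state or a verdict. *)
Inductive clock_state (S : Type) :=
| Next | SetClock | Back | Copy | Run (q : S) | Mark (q : S) | Seek (x : S + bool)
| Advance (q : S) | Return (q : S) | Clear | SeekIndex.

Section ClockStateFinite.
Variable S : finType.

Definition clock_state_code : finType := ('I_6 + (S + S + (S + bool) + S + S))%type.

Definition clock_state_enc (s : clock_state S) : clock_state_code :=
  match s with
  | Next => inl (inord 0) | SetClock => inl (inord 1) | Back => inl (inord 2)
  | Copy => inl (inord 3) | Clear => inl (inord 4) | SeekIndex => inl (inord 5)
  | Run q => inr (inl (inl (inl (inl q)))) | Mark q => inr (inl (inl (inl (inr q))))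
  | Seek x => inr (inl (inl (inr x))) | Advance q => inr (inl (inr q))
  | Return q => inr (inr q)
  end.

Definition clock_state_dec (x : clock_state_code) : clock_state S :=
  match x with
  | inl i => match nat_of_ord i with
             | 0 => Next _ | 1 => SetClock _ | 2 => Back _
             | 3 => Copy _ | 4 => Clear _ | _ => SeekIndex _ end
  | inr (inl (inl (inl (inl q)))) => Run q
  | inr (inl (inl (inl (inr q)))) => Mark q
  | inr (inl (inl (inr x))) => Seek x
  | inr (inl (inr q)) => Advance q
  | inr (inr q) => Return q
  end.

Lemma clock_state_encK : cancel clock_state_enc clock_state_dec.
Proof. by case=> //=; rewrite inordK. Qed.

HB.instance Definition _ := Finite.copy (clock_state S) (can_type clock_state_encK).

End ClockStateFinite.

#[local] Arguments input : simpl never.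

Lemma input_some w z : (0 <= z < Z.of_nat (size w))%Z -> input w z = true :> bool.
Proof. by move=> h; rewrite /input; case: Z.leb_spec => ?; rewrite ?onthTE; lia. Qed.

Lemma input_none w z : (z < 0 \/ Z.of_nat (size w) <= z)%Z -> input w z = None.
Proof.
move=> h; rewrite /input; case: Z.leb_spec => // ?.
by rewrite onth_default //; lia.
Qed.

Lemma input_take j w z : (z < Z.of_nat j)%Z -> input (take j w) z = input w z.
Proof.
move=> h; rewrite /input; case: Z.leb_spec => // h0.
by rewrite !onthE map_take nth_take //; lia.
Qed.

Definition delayed S (delta : S -> option bool -> bool + S * option bool * option bool)
    (s0 : S) (w : seq bool) : bool :=
  has (fun j => verdict_at delta (size w - j - 1) s0 0 (input (take j w)) == Some true)
      (iota 0 (size w)).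

(** * The four-track machine and its sweeps *)

Section Clocked.
Variable S : finType.
Variable delta : S -> option bool -> bool + S * option bool * option bool.
Variable s0 : S.

Notation left := (Some false).
Notation right := (Some true).
Notation cell := ((option bool * option bool) * (option bool * option bool))%type.

(* The four tracks of a cell are: the input (read-only); the tape of the
   simulated machine; [f], which is nonblank on the cells visited by the simulated
   machine and [Some true] only at its saved head position; and [g], which is
   [Some false] at the length [j] of the prefix under examination and [Some true]
   at the clock, started at [j + 1] and advanced once per simulated step. *)
Definition clock_delta (s : clock_state S) (c : cell) : bool + clock_state S * cell * option bool :=
  let: ((y, m), (f, g)) := c in
  match s with
  | Next => if y then inr (SetClock _, ((y, m), (f, Some false)), right) else inl false
  | SetClock => inr (Back _, ((y, m), (f, Some true)), left)
  | Back => inr (Copy _, c, left)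
  | Copy => if y then inr (Copy _, ((y, y), (f, g)), left) else inr (Run s0, c, right)
  | Run q => match delta q m with
             | inl b => inr (Seek (inr b), ((y, m), (Some false, g)), None)
             | inr (q', a, mv) => inr (Mark q', ((y, a), (Some false, g)), mv)
             end
  | Mark q => inr (Seek (inl q), ((y, m), (Some true, g)), None)
  | Seek x => if g == Some true then
                match x, y with
                | inl q, Some _ => inr (Advance q, ((y, m), (f, None)), right)
                | inr true, None => inl true
                | _, _ => inr (Clear _, ((y, None), (None, None)), left)
                end
              else inr (Seek x, c, right)
  | Advance q => inr (Return q, ((y, m), (f, Some true)), left)
  | Return q => if f == Some true then inr (Run q, ((y, m), (Some false, g)), None)
                else inr (Return q, c, left)
  | Clear => if y || f then inr (Clear _, ((y, None), (None, g)), left)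
             else inr (SeekIndex _, c, right)
  | SeekIndex => if g == Some false then inr (Next _, ((y, m), (f, None)), right)
                 else inr (SeekIndex _, c, right)
  end.

Notation H := (halts clock_delta).

Definition blank (z : Z) : option bool := None.

Definition index_mark (j z : Z) : option bool := if Z.eqb z j then Some false else None.

Definition clock_marks (j c z : Z) : option bool :=
  if Z.eqb z j then Some false else if Z.eqb z c then Some true else None.

Variable w : seq bool.

Notation n := (Z.of_nat (size w)).

Definition tracks (mu phi gam : Z -> option bool) (z : Z) : cell :=
  ((input w z, mu z), (phi z, gam z)).

(** Supplying the new tracks up to pointwise equality keeps them in closed form instead of nested
    updates. *)
Lemma halts_tracks B q p mu phi gam b q' x y v m mu' phi' gam' :
  clock_delta q (tracks mu phi gam p) = inr (q', ((input w p, x), (y, v)), m) ->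
  mu' =1 upd mu p x -> phi' =1 upd phi p y -> gam' =1 upd gam p v ->
  H B q' (p + disp m)%Z (tracks mu' phi' gam') b -> H B.+1 q p (tracks mu phi gam) b.
Proof.
move=> e emu ephi egam hB; apply: (halts_step e); apply: halts_ext hB => z.
by rewrite /tracks emu ephi egam /upd; case: Z.eqb_spec => // ->.
Qed.

Lemma upd_id A (T : Z -> A) p : T =1 upd T p (T p).
Proof. by move=> z; rewrite /upd; case: Z.eqb_spec => // ->. Qed.

(** The input from 0 on and the visited marks from [lo] to -1 leave no hole, so the sweep turns
    exactly at [lo - 1]. *)
Lemma halts_Clear B mu phi j lo z k b : (z - lo + 1 = Z.of_nat k)%Z ->
  (lo <= 0)%Z -> (z < n)%Z ->
  (forall x, (x < lo \/ z < x)%Z -> mu x = None /\ phi x = None) ->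
  (forall x, (lo <= x < 0)%Z -> (x <= z)%Z -> phi x) ->
  H B (SeekIndex _) lo (tracks blank blank (index_mark j)) b ->
  H (B + k.+1) (Clear _) z (tracks mu phi (index_mark j)) b.
Proof.
elim: k z mu phi => [|k IH] z mu phi ek lo0 zn hout hin hB; rewrite addnS.
  have ez : (z = lo - 1)%Z by lia.
  have [|_ phiz] := hout z; first by lia.
  apply: halts_move; first by rewrite /= phiz input_none //; lia.
  rewrite ez /= (_ : (lo - 1 + 1)%Z = lo); last by lia.
  rewrite addn0; apply: halts_ext hB => x.
  by rewrite /tracks; have [|-> ->] := hout x; first by lia.
apply: (@halts_tracks _ _ _ _ _ _ _ (Clear S) None None (index_mark j z) left
  (upd mu z None) (upd phi z None) (index_mark j)) => //.
- rewrite /=; case: (Z.leb_spec 0 z) => h.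
    by rewrite input_some //; lia.
  by rewrite hin ?orbT //; lia.
- exact: upd_id.
apply: (IH (z + disp left)%Z) => //=; try lia.
- move=> x hx; rewrite /upd; case: Z.eqb_spec => [//|ne].
  by apply: hout; lia.
- by move=> x hx hz; rewrite upd_neq; [apply: hin|]; lia.
Qed.

Lemma halts_SeekIndex B j z k b : (z + Z.of_nat k = j)%Z ->
  H B (Next _) (j + 1)%Z (tracks blank blank blank) b ->
  H (B + k.+1) (SeekIndex _) z (tracks blank blank (index_mark j)) b.
Proof.
move=> ek hB; elim: k z ek => [|k IH] z ek; rewrite addnS.
  have {z ek} -> : z = j by lia.
  rewrite addn0; apply: (halts_tracks (m := right) _ _ _ _ hB); first by rewrite /= /index_mark Z.eqb_refl.
  - exact: upd_id.
  - exact: upd_id.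
  - by move=> z; rewrite /upd /index_mark; case: Z.eqb_spec.
apply: halts_move; first by rewrite /= {1}/index_mark; case: Z.eqb_spec => //; lia.
by apply: IH; rewrite /=; lia.
Qed.

Lemma halts_cleanup B mu phi j lo z b :
  (- n <= lo <= 0)%Z -> (lo <= z + 1)%Z -> (z < n)%Z -> (0 <= j < n)%Z ->
  (forall x, (x < lo \/ z < x)%Z -> mu x = None /\ phi x = None) ->
  (forall x, (lo <= x < 0)%Z -> phi x) ->
  H B (Next _) (j + 1)%Z (tracks blank blank blank) b ->
  H (B + (4 * size w + 2)) (Clear _) z (tracks mu phi (index_mark j)) b.
Proof.
move=> hlo hz hzn hj hout hin hB.
apply: (@halts_mono _ _ _ (B + (Z.to_nat (j - lo)).+1 + (Z.to_nat (z - lo + 1)).+1)).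
  by lia.
apply: (@halts_Clear _ _ _ _ lo); try lia; try done.
  by move=> x hx _; apply: hin.
by apply: halts_SeekIndex hB; lia.
Qed.

Lemma halts_Seek B x mu phi j c z k b : (z + Z.of_nat k = c)%Z ->
  H B (Seek x) c (tracks mu phi (clock_marks j c)) b ->
  H (B + k) (Seek x) z (tracks mu phi (clock_marks j c)) b.
Proof.
move=> ek hB; elim: k z ek => [|k IH] z ek.
  by rewrite addn0 (_ : z = c) //; lia.
rewrite addnS; apply: halts_move.
  by rewrite /= {1}/clock_marks; do 2 case: Z.eqb_spec => //; lia.
by apply: IH; rewrite /=; lia.
Qed.

Lemma halts_Return B q mu phi gam h z k b : (h + Z.of_nat k = z)%Z ->
  (forall x, (h < x)%Z -> phi x <> Some true) ->
  H B (Return q) h (tracks mu phi gam) b ->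
  H (B + k) (Return q) z (tracks mu phi gam) b.
Proof.
move=> ek hphi hB; elim: k z ek => [|k IH] z ek.
  by rewrite addn0 (_ : z = h) //; lia.
rewrite addnS; apply: halts_move.
  by rewrite /=; case: eqP => // /hphi; case; lia.
by apply: IH; rewrite /=; lia.
Qed.

(** The sweep runs leftwards: the cells from [i] on are already copied, and the blank at -1 ends
    it. *)
Lemma halts_Copy B j gam i b : i <= j -> j < size w ->
  H B (Run s0) 0%Z (tracks (input (take j w)) blank gam) b ->
  H (B + i.+1) (Copy _) (Z.of_nat i - 1)%Z
    (tracks (fun z => if (Z.of_nat i <=? z)%Z then input (take j w) z else None) blank gam) b.
Proof.
move=> ij jn hB; elim: i ij => [|i IH] ij; rewrite addnS.
  apply: halts_move; first by [].
  rewrite addn0; apply: halts_ext hB => z; rewrite /tracks.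
  by case: Z.leb_spec => // hz; rewrite [input (take _ _) _]input_none //; lia.
have -> : (Z.of_nat i.+1 - 1 = Z.of_nat i)%Z by lia.
have hy : input w (Z.of_nat i) by apply: input_some; lia.
have {}IH := IH (ltnW ij).
apply: (halts_tracks (m := left) _ _ _ _ IH).
- by rewrite /= hy.
- move=> z; rewrite /upd /=; case: Z.eqb_spec => [->|ne].
    by rewrite Z.leb_refl input_take //; lia.
  by do 2 case: Z.leb_spec => //; lia.
- exact: upd_id.
- exact: upd_id.
Qed.

(** A prefix fails in three ways: rejection, a halt before the clock reaches the end of the input,
    or a clock at the end with the simulated machine still running. *)
Lemma halts_stop B x mu phi j c lo b :
  (- n <= lo <= 0)%Z -> (0 <= j < c)%Z -> (c <= n)%Z ->
  (forall z, (z < lo \/ c < z)%Z -> mu z = None /\ phi z = None) ->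
  (forall z, (lo <= z < 0)%Z -> phi z) ->
  (if x is inr v then (c < n)%Z \/ v = false else c = n) ->
  H B (Next _) (j + 1)%Z (tracks blank blank blank) b ->
  H (B + (4 * size w + 3)) (Seek x) c (tracks mu phi (clock_marks j c)) b.
Proof.
move=> hlo hj hc hout hin hx hB.
have -> : B + (4 * size w + 3) = (B + (4 * size w + 2)).+1 by lia.
have gc : clock_marks j c c = Some true.
  by rewrite /clock_marks Z.eqb_refl; case: Z.eqb_spec => //; lia.
apply: (@halts_tracks _ _ _ _ _ _ _ (Clear S) None None None left
  (upd mu c None) (upd phi c None) (index_mark j)) => //.
- rewrite /= gc /=; case: x hx => [q ec|v hv]; first by rewrite input_none //; lia.
  case: v hv => [[cn|//]|_]; last by case: (input w c).
  have : input w c by apply: input_some; lia.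
  by case: (input w c).
- by move=> z; rewrite /upd /index_mark /clock_marks; do 2 case: Z.eqb_spec => //; lia.
apply: (@halts_cleanup _ _ _ _ lo); rewrite /=; try lia; try done.
- move=> z hz; rewrite /upd; case: Z.eqb_spec => [//|ne].
  by apply: hout; lia.
- by move=> z hz; rewrite upd_neq; [apply: hin|lia].
Qed.

(* After [s] simulated steps on the prefix of length [j], with [q] and [h] the
   simulated state and head, the visited cells reach down to [lo]. *)
Record simulating (j s : nat) (lo h : Z) (mu phi : Z -> option bool) : Prop := Simulating {
  sim_lo : (- Z.of_nat s <= lo <= 0)%Z;
  sim_head : (lo <= h <= Z.of_nat s)%Z;
  sim_out : forall x, (x < lo \/ Z.of_nat (j + s) < x)%Z -> mu x = None /\ phi x = None;
  sim_visited : forall x, (lo <= x < 0)%Z -> phi x;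
  sim_unmarked : forall x, phi x <> Some true }.

(** The new head cell receives [Some false]: the invariant describes the moments in [Run], when no
    head mark is present. *)
Lemma simulating_step j s lo h mu phi a h' : simulating j s lo h mu phi ->
  (h - 1 <= h' <= h + 1)%Z ->
  simulating j s.+1 (Z.min lo h') h' (upd mu h a) (upd (upd phi h (Some false)) h' (Some false)).
Proof.
move=> [hlo hh hout hv hu] hh'; split; try lia.
- move=> x hx; rewrite !upd_neq; try lia.
  by apply: hout; lia.
- move=> x hx; rewrite /upd; do 2 case: Z.eqb_spec => // ?.
  by apply: hv; lia.
- by move=> x; rewrite /upd; do 2 case: Z.eqb_spec => // _.
Qed.

(** First half of a round: simulate a step, mark the head, walk to the clock. *)
Lemma halts_Run_Seek B j s lo h mu phi q q' a mv b :
  let h' := (h + disp mv)%Z in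
  let c := Z.of_nat (j + s + 1) in
  simulating j s lo h mu phi -> j + s < size w -> delta q (mu h) = inr (q', a, mv) ->
  H B (Seek (inl q')) c (tracks (upd mu h a) (upd (upd phi h (Some false)) h' (Some true))
    (clock_marks (Z.of_nat j) c)) b ->
  H (B + (2 * size w + 2)) (Run q) h (tracks mu phi (clock_marks (Z.of_nat j) c)) b.
Proof.
move=> h' c [hlo hh _ _ _] jsn ed hB.
have hh' : (h - 1 <= h' <= h + 1)%Z by rewrite /h'; case: (mv) => [[]|] /=; lia.
apply: (@halts_mono _ _ _ (B + Z.to_nat (c - h')).+2); first by lia.
apply: (@halts_tracks _ _ _ _ _ _ _ (Mark q') a (Some false)
  (clock_marks (Z.of_nat j) c h) mv (upd mu h a) (upd phi h (Some false))
  (clock_marks (Z.of_nat j) c)) => //; [by rewrite /= ed | exact: upd_id |].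
apply: (@halts_tracks _ _ _ _ _ _ _ (Seek (inl q')) (upd mu h a h') (Some true)
  (clock_marks (Z.of_nat j) c h') None (upd mu h a)
  (upd (upd phi h (Some false)) h' (Some true)) (clock_marks (Z.of_nat j) c)) => //;
  [exact: upd_id | exact: upd_id |].
by rewrite Z.add_0_r; apply: halts_Seek => //; lia.
Qed.

(** Second half: the clock ticks, and the head is recovered from the only [Some true] of [f]. *)
Lemma halts_Seek_Run B j s lo h mu phi q b :
  let c := Z.of_nat (j + s + 1) in
  simulating j s.+1 lo h mu (upd phi h (Some false)) -> j + s + 1 < size w ->
  H B (Run q) h (tracks mu (upd phi h (Some false))
     (clock_marks (Z.of_nat j) (Z.of_nat (j + s.+1 + 1)))) b ->
  H (B + (2 * size w + 4)) (Seek (inl q)) c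
    (tracks mu (upd phi h (Some true)) (clock_marks (Z.of_nat j) c)) b.
Proof.
move=> c [hlo hh _ _ hu] jsn hB.
have ec : Z.of_nat (j + s.+1 + 1) = (c + 1)%Z by lia.
rewrite ec in hB.
apply: (@halts_mono _ _ _ (B.+1 + Z.to_nat (c - h)).+2); first by lia.
have gc : clock_marks (Z.of_nat j) c c = Some true.
  by rewrite /clock_marks Z.eqb_refl; case: Z.eqb_spec => //; lia.
apply: (@halts_tracks _ _ _ _ _ _ _ (Advance q) (mu c) (upd phi h (Some true) c) None right
  mu (upd phi h (Some true)) (index_mark (Z.of_nat j))).
- rewrite /= gc /=; have : input w c by apply: input_some; lia.
  by case: (input w c).
- exact: upd_id.
- exact: upd_id.
- by move=> z; rewrite /upd /index_mark /clock_marks; do 2 case: Z.eqb_spec => //; lia.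
apply: (@halts_tracks _ _ _ _ _ _ _ (Return q) (mu (c + 1)%Z) (upd phi h (Some true) (c + 1)%Z)
  (Some true) left mu (upd phi h (Some true)) (clock_marks (Z.of_nat j) (c + 1)%Z)) => //.
- exact: upd_id.
- exact: upd_id.
- by move=> z; rewrite /= /upd /index_mark /clock_marks; do 2 case: Z.eqb_spec => //; lia.
rewrite /= (_ : (c + 1 + -1)%Z = c); last by lia.
apply: (@halts_Return _ _ _ _ _ h); first by lia.
  by move=> x hx; have := hu x; rewrite !upd_neq //; lia.
apply: (@halts_tracks _ _ _ _ _ _ _ (Run q) (mu h) (Some false)
  (clock_marks (Z.of_nat j) (c + 1)%Z h) None mu (upd phi h (Some false))
  (clock_marks (Z.of_nat j) (c + 1)%Z)).
- by rewrite /= upd_eq eqxx.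
- exact: upd_id.
- by move=> z; rewrite /upd; case: Z.eqb_spec.
- exact: upd_id.
by rewrite Z.add_0_r.
Qed.

(** Induction on the [k] steps left on the clock; [b] is the answer of the later candidates, reached
    through [Next] when this one fails. *)
Lemma halts_Run B j s k lo q h mu phi b : j + s + k.+1 = size w ->
  simulating j s lo h mu phi ->
  H B (Next _) (Z.of_nat j + 1)%Z (tracks blank blank blank) b ->
  H (B + k.+1 * (8 * size w + 10)) (Run q) h
    (tracks mu phi (clock_marks (Z.of_nat j) (Z.of_nat (j + s + 1))))
    ((verdict_at delta k q h mu == Some true) || b).
Proof.
move=> en sim hB; elim: k s lo q h mu phi en sim => [|k IH] s lo q h mu phi en sim;
  have [hlo hh hout hv hu] := sim; set c := Z.of_nat (j + s + 1);
  rewrite [verdict_at _ _ _ _ _]/=; case ed: (delta q (mu h)) => [v|[[q' a] mv]].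
(* A halt exactly on time: the clock stands on the blank after the input, where acceptance is
   final. *)
- apply: (@halts_mono _ _ _ ((B + (4 * size w + 3)) + Z.to_nat (c - h)).+1); first by lia.
  apply: (@halts_tracks _ _ _ _ _ _ _ (Seek (inr v)) (mu h) (Some false)
    (clock_marks (Z.of_nat j) c h) None mu (upd phi h (Some false)) (clock_marks (Z.of_nat j) c)).
  + by rewrite /= ed.
  + exact: upd_id.
  + by [].
  + exact: upd_id.
  rewrite Z.add_0_r; apply: halts_Seek; first by lia.
  case: v ed => ed.
    apply: halts_now; rewrite /= input_none; last by lia.
    by rewrite /clock_marks Z.eqb_refl; case: Z.eqb_spec => //; lia.
  apply: (@halts_stop _ _ _ _ _ _ lo) => //; try lia.
  + by move=> z hz; rewrite upd_neq; [apply: hout|]; lia.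
  + by move=> z hz; rewrite /upd; case: Z.eqb_spec => // _; apply: hv.
(* Still running when the clock has reached the end. *)
- set h' := (h + disp mv)%Z.
  have hh' : (h - 1 <= h' <= h + 1)%Z by rewrite /h'; case: (mv) => [[]|] /=; lia.
  apply: (@halts_mono _ _ _ (B + (4 * size w + 3) + (2 * size w + 2))); first by lia.
  apply: (halts_Run_Seek sim _ ed); first by lia.
  apply: (@halts_stop _ _ _ _ _ _ (Z.min lo h')) => //; try lia.
  + by move=> z hz; rewrite !upd_neq; try lia; apply: hout; lia.
  + move=> z hz; rewrite /upd; do 2 case: Z.eqb_spec => // ?.
    by apply: hv; lia.
(* A halt too early, which counts as failure whatever the verdict. *)
- apply: (@halts_mono _ _ _ ((B + (4 * size w + 3)) + Z.to_nat (c - h)).+1); first by nia.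
  apply: (@halts_tracks _ _ _ _ _ _ _ (Seek (inr v)) (mu h) (Some false)
    (clock_marks (Z.of_nat j) c h) None mu (upd phi h (Some false)) (clock_marks (Z.of_nat j) c)).
  + by rewrite /= ed.
  + exact: upd_id.
  + by [].
  + exact: upd_id.
  rewrite Z.add_0_r; apply: halts_Seek; first by lia.
  apply: (@halts_stop _ _ _ _ _ _ lo) => //; try lia.
  + by move=> z hz; rewrite upd_neq; [apply: hout|]; lia.
  + by move=> z hz; rewrite /upd; case: Z.eqb_spec => // _; apply: hv.
- set h' := (h + disp mv)%Z.
  have hh' : (h - 1 <= h' <= h + 1)%Z by rewrite /h'; case: (mv) => [[]|] /=; lia.
  have sim' := simulating_step a sim hh'.
  apply: (@halts_mono _ _ _ (B + k.+1 * (8 * size w + 10) + (2 * size w + 4) + (2 * size w + 2))).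
    by nia.
  apply: (halts_Run_Seek sim _ ed); first by lia.
  apply: (halts_Seek_Run sim'); first by lia.
  by apply: IH sim'; lia.
Qed.

(** A failed candidate leaves all working tracks blank and the head at [j + 1], so the next one
    starts afresh; the first blank after the input ends the search. *)
Lemma halts_Next j k : j + k = size w ->
  H (k * (size w * (8 * size w + 10) + size w + 5) + 1) (Next _) (Z.of_nat j)
    (tracks blank blank blank)
    (has (fun i => verdict_at delta (size w - i - 1) s0 0 (input (take i w)) == Some true)
         (iota j k)).
Proof.
elim: k j => [|k IH] j jk; first by apply: halts_now; rewrite /= input_none //; lia.
have jn : j < size w by lia.
have {}IH := IH j.+1; rewrite [has _ _]/=.
set b := has _ _ in IH *.
set t := k * _ + 1 in IH.
have {}IH : H t (Next _) (Z.of_nat j + 1)%Z (tracks blank blank blank) b.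
  by rewrite (_ : (Z.of_nat j + 1)%Z = Z.of_nat j.+1); [apply: IH|]; lia.
apply: (@halts_mono _ _ _ ((t + k.+1 * (8 * size w + 10)) + j.+1).+3); first by rewrite /t; nia.
apply: (@halts_tracks _ _ _ _ _ _ _ (SetClock _) None None (Some false) right
  blank blank (index_mark (Z.of_nat j))) => //.
- rewrite /=; have : input w (Z.of_nat j) by apply: input_some; lia.
  by case: (input w _).
- exact: upd_id.
- exact: upd_id.
have ej : Z.of_nat (j + 0 + 1) = (Z.of_nat j + 1)%Z by lia.
apply: (@halts_tracks _ _ _ _ _ _ _ (Back _) None None (Some true) left
  blank blank (clock_marks (Z.of_nat j) (Z.of_nat (j + 0 + 1)))) => //.
- exact: upd_id.
- exact: upd_id.
- by move=> z; rewrite ej /upd /index_mark /clock_marks; do 2 case: Z.eqb_spec => //=; lia.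
rewrite /= (_ : (Z.of_nat j + 1 + -1)%Z = Z.of_nat j); last by lia.
apply: halts_move; first by [].
(* Before the sweep nothing is copied: the prefix has no symbol at [j] or beyond. *)
have e0 : tracks (fun z => if (Z.of_nat j <=? z)%Z then input (take j w) z else None) blank
            (clock_marks (Z.of_nat j) (Z.of_nat (j + 0 + 1))) =1
          tracks blank blank (clock_marks (Z.of_nat j) (Z.of_nat (j + 0 + 1))).
  move=> z; rewrite /tracks; case: Z.leb_spec => // hz.
  by rewrite [input (take j w) z]input_none // size_take jn; right; lia.
apply: halts_ext e0 _; apply: halts_Copy => //.
have -> : size w - j - 1 = k by lia.
apply: (@halts_Run _ _ _ _ 0%Z) => //; first by lia.
split=> //; try lia.
by move=> x hx; rewrite input_none // size_take jn; lia.
Qed.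

End Clocked.

Lemma ptime_on_delayed (S : finType)
    (delta : S -> option bool -> bool + S * option bool * option bool) (s0 : S) :
  ptime_on (fun o : option bool => ((o, None : option bool), (None : option bool, None : option bool)))
    (delayed delta s0).
Proof.
(* At most [size w] candidates, each with at most [size w] rounds of linear length, give a cubic
   bound. *)
exists (clock_state S : finType), (clock_delta delta s0), (Next _), 30, 3 => w.
apply: halts_mono (halts_Next delta s0 (add0n (size w))).
by rewrite !expnS expn0; nia.
Qed.

Lemma ptime_delayed (S : finType)
    (delta : S -> option bool -> bool + S * option bool * option bool) (s0 : S) :
  ptime_lf (delayed delta s0).
Proof.
(* Four tracks are a pair of pairs, so two reductions suffice. *)
apply: ptime_on_id; apply: (@ptime_on_pair _ id id) => //.
apply: (@ptime_on_pair _ (fun o => (o, None : option bool)) fst) => //.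
exact: ptime_on_delayed.
Qed.

(** * The delayed learning function *)

Lemma prefix_take Y m j : j <= m -> take j (Defs.prefix Y m) = Defs.prefix Y j.
Proof. by move=> jm; rewrite /Defs.prefix /mkseq -map_take take_iota (minn_idPl jm). Qed.

Lemma lambda_le_sub (A B : (nat -> bool) -> Prop) b :
  (forall Y, A Y -> B Y) -> lambda_le B b -> lambda_le A b.
Proof.
move=> AB hB eps eps0; have [c [cov sum]] := hB eps eps0.
by exists c; split=> // Y /AB /cov.
Qed.

Section Delayed.
Variables (M : TM) (l : seq bool -> bool).
Hypothesis Ml : forall w, exists k (c : config M), exec k (init M w) = Some c /\ output c = l w.

Notation run w k := (verdict_at (@delta_of M) k ord0 0%Z (input w)).
Notation l' := (delayed (@delta_of M) ord0).

Lemma run_halts w : exists t, run w t = Some (l w).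
Proof.
have [k [c [hc <-]]] := Ml w.
have [t ht] := exec_verdict (tape_of_init M w) hc.
by exists t; case: w ht {hc}.
Qed.

Lemma run_verdict w k b : run w k = Some b -> b = l w.
Proof. by move=> h; have [t ht] := run_halts w; have [] := verdict_at_inj h ht. Qed.

Lemma delayed_often X : (forall N, exists m, N <= m /\ l (Defs.prefix X m)) ->
  forall N, exists m, N <= m /\ l' (Defs.prefix X m).
Proof.
move=> often N; have [m [Nm lm]] := often N.
have [t ht] := run_halts (Defs.prefix X m).
(* At this length the candidate [m] is granted exactly its running time [t]. *)
exists (m + t + 1); split; first by lia.
apply/hasP; exists m; first by rewrite mem_iota size_mkseq; lia.
rewrite prefix_take; last by lia.
rewrite size_mkseq (_ : m + t + 1 - m - 1 = t) ?ht ?lm //; lia.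
Qed.

(* A yes of [l'] at length [m] comes from a yes of [l] at some [j] whose run takes
   exactly [m - j - 1] steps; so [j] determines [m]. *)
Lemma at_least_n_yes_delayed n Y : at_least_n_yes l' n Y -> at_least_n_yes l n Y.
Proof.
move=> [s [us [ns ls]]].
pose P m j := run (Defs.prefix Y j) (m - j - 1) == Some true.
pose f m := find (P m) (iota 0 m).
have fP m : m \in s -> f m < m /\ P m (f m).
  move/(allP ls); rewrite /delayed size_mkseq => h.
  have {}h : has (P m) (iota 0 m).
    case/hasP: h => j; rewrite mem_iota => jm; rewrite prefix_take; last by lia.
    by move=> h; apply/hasP; exists j => //; rewrite mem_iota.
  have := h; rewrite has_find size_iota => lt; split=> //.
  by have := nth_find 0 h; rewrite nth_iota.
exists (map f s); split; last split.
(* A common [j] forces [m - j - 1 = m' - j - 1] by determinism; as [j] lies below both, [m = m']. *)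
- rewrite map_inj_in_uniq // => m m' /fP [lt /eqP e] /fP [lt' /eqP e'] ef.
  rewrite -ef in lt' e'.
  by have [] := verdict_at_inj e e'; lia.
- by rewrite size_map.
- apply/allP => _ /mapP [m /fP [_ /eqP e] ->].
  by rewrite -(run_verdict e).
Qed.

Lemma delayed_detects X : uniformly_weakly_detects l X -> uniformly_weakly_detects l' X.
Proof.
move=> [often few]; split; first exact: delayed_often.
by move=> n; apply: lambda_le_sub (few n) => Y; apply: at_least_n_yes_delayed.
Qed.

End Delayed.

Theorem mainTheorem1 (X : nat -> bool) :
  (exists l : seq bool -> bool, computable_lf l /\ uniformly_weakly_detects l X) <->
  (exists l : seq bool -> bool, ptime_lf l /\ uniformly_weakly_detects l X).
Proof.
split=> [[l [[M Ml] hl]]|[l [[M [a [d Ml]]] hl]]].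
  exists (delayed (@delta_of M) ord0); split; first exact: ptime_delayed.
  exact: delayed_detects hl.
(* The polynomial bound itself serves as the number of steps. *)
exists l; split=> //; exists M => w.
by have [c hc] := Ml w; exists (a * (size w).+1 ^ d), c.
Qed.
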